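(* Any deterministic algorithm for triangle detection in the CONGEST$(1)$ model requires $\Omega(\log^* N)$ rounds, even for graphs of maximum degree $2$ with only $6$ nodes, given a namespace of size $N$. That is, there exist constants $c>0$ and $N_0$ such that for every $N\ge N_0$, every deterministic algorithm in the CONGEST$(1)$ model that solves the triangle detection problem on all $6$-node graphs of maximum degree at most $2$ whose nodes have distinct IDs from $[N]$ uses at least $c\log^* N$ rounds.
   Context: CONGEST$(1)$ model (with $KT_1$ knowledge): the network is a simple undirected graph whose nodes have distinct IDs in the namespace $[N]=\{1,\dots,N\}$. Initially each node knows its own ID and the IDs of its neighbors (and the global parameters: the number of nodes and $N$), and nothing else about the graph. Computation proceeds in synchronous rounds; in each round each node sends a message of exactly one bit to each of its neighbors (possibly different messages to different neighbors). The message sent in a round is a function of the initial knowledge of the node and the messages received in previous rounds; local computation is unbounded. After the last round each node produces an output determined by its initial knowledge and all messages it received. An algorithm solves a problem on a class of graphs if it is correct for every graph in the class and every assignment of distinct IDs from $[N]$. Triangle detection problem: if the graph contains no triangle then every node outputs NO; if the graph contains a triangle then at least one node outputs YES. $\log^* N$ is the iterated logarithm: the number of times $\log_2$ must be applied to $N$ until the result is at most $1$. *)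

(* Defs.v *)
From mathcomp Require Import all_boot all_order all_algebra.
From mathcomp Require Import reals exp.

Set Implicit Arguments.
Unset Strict Implicit.
Unset Printing Implicit Defensive.
Import Order.TTheory GRing.Theory Num.Theory.

Record sgraph (V : finType) := SGraph {
  adj :> rel V;
  adj_sym : symmetric adj;
  adj_irr : irreflexive adj
}.

Section Graphs.
Variables (V : finType) (G : sgraph V).

Definition nbrs (v : V) : {set V} := [set u | G v u].

Definition max_degree : nat := \max_(v : V) #|nbrs v|.

Definition has_triangle : Prop := exists u v w : V, [/\ G u v, G v w & G w u].

End Graphs.

(* The namespace of size N is 'I_N, i.e. {0, ..., N-1} rather than             *)
(* {1, ..., N}: IDs are shifted by one.                                       *)

(* The bits received in one round, indexed by the sender's ID; the value is   *)
(* None at IDs that are not those of a neighbor.                              *)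
Definition inbox (N : nat) := {ffun 'I_N -> option bool}.

(* A deterministic CONGEST(1) algorithm with KT_1 knowledge, for a fixed      *)
(* namespace size N and a fixed number of nodes; it may thus depend           *)
(* arbitrarily on these two global parameters.                                *)
(*  - [send x nb h y] is the bit that a node with ID x, neighbor IDs nb and   *)
(*    inboxes h of the previous rounds (oldest first) sends to its neighbor   *)
(*    with ID y. The round number is size h.                                  *)
(*  - [output x nb h] is the final output, true standing for YES and false    *)
(*    for NO.                                                                 *)
Record algorithm (N : nat) := Algorithm {
  rounds : nat;
  send : 'I_N -> {set 'I_N} -> seq (inbox N) -> 'I_N -> bool;
  output : 'I_N -> {set 'I_N} -> seq (inbox N) -> bool
}.

Section Execution.
Variables (N : nat) (A : algorithm N).
Variables (V : finType) (G : sgraph V) (id : V -> 'I_N).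

Definition nbr_ids (v : V) : {set 'I_N} := [set id u | u in nbrs G v].

Fixpoint received (t : nat) (v : V) : seq (inbox N) :=
  if t is s.+1 then
    rcons (received s v)
      [ffun i => omap (fun u => send A (id u) (nbr_ids u) (received s u) (id v))
                      [pick u in nbrs G v | id u == i]]
  else [::].

Definition node_output (v : V) : bool :=
  output A (id v) (nbr_ids v) (received (rounds A) v).

End Execution.

Definition solves_triangle_detection (N : nat) (A : algorithm N)
    (V : finType) (C : sgraph V -> Prop) : Prop :=
  forall (G : sgraph V) (id : V -> 'I_N), C G -> injective id ->
    (~ has_triangle G -> forall v, node_output A G id v = false) /\
    (has_triangle G -> exists v, node_output A G id v = true).

Local Open Scope ring_scope.

Section LogStar.
Variable R : realType.

Definition log2 (x : R) : R := ln x / ln 2.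

Lemma log2_le_nat (x : R) (n : nat) : x <= n.+2%:R -> log2 x <= n.+1%:R.
Proof.
move=> xn; have ln2_gt0 : 0 < ln (2 : R) by rewrite ln_gt0 // ltr1n.
rewrite /log2 ler_pdivrMr //.
have [x_le0|x_gt0] := leP x 0.
  by rewrite (ln0 x_le0) mulr_ge0 // ltW.
rewrite mulr_natl -lnXn // ler_ln ?posrE ?exprn_gt0 //.
by apply: (le_trans xn); rewrite -natrX ler_nat ltn_expl.
Qed.

Lemma log_star_subproof (n : nat) : exists k, iter k log2 n%:R <= 1.
Proof.
suff H m (x : R) : x <= m.+1%:R -> exists k, iter k log2 x <= 1.
  by apply: (H n); rewrite ler_nat.
elim: m x => [x x1|m IH x xm]; first by exists 0%N.
have [k kP] := IH _ (log2_le_nat xm).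
by exists k.+1; rewrite iterSr.
Qed.

Definition log_star (n : nat) : nat := ex_minn (log_star_subproof n).

End LogStar.

(* Main.v *)
(* Label a triangle by the IDs (a, b, c) of its nodes, and color (a, b, c) by  *)
(* the whole transcript of the execution. With T rounds there are 2^O(T)      *)
(* colors, so if N exceeds 2^O(T), pigeonholing on c, then b, then a gives    *)
(* pairs a0 <> a1, b0 <> b1, c0 <> c1 all of whose 8 triples have the same    *)
(* color. The hexagon a0 b0 c0 a1 b1 c1 double covers the triangle, and       *)
(* each of its nodes sees the neighborhood of a node of one of these          *)
(* triangles; hence it receives the common transcript and answers as in a     *)
(* triangle. This gives even T = Omega(log N).                                *)

Require Import Defs.
From mathcomp Require Import all_boot all_order all_algebra.
From mathcomp Require Import reals exp.
From mathcomp Require Import zify.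
Import Order.TTheory GRing.Theory Num.Theory.

Set Implicit Arguments.
Unset Strict Implicit.
Unset Printing Implicit Defensive.

(** The hexagon has no triangle and must answer NO, yet labelings with a common transcript carry a
    YES over to it: this is [hexagon_distinguished]. With T rounds, [monochromatic_box] supplies
    such labelings as soon as N reaches 2^(324T+65), whence [namespace_bound]. Since log* N is at
    most of order log N ([log_star_le]), this logarithmic bound suffices. *)

(** * Pigeonhole for boxes *)

Lemma monochromatic_pair (X K : finType) (f : X -> K) : (#|K| < #|X|)%N ->
  exists p : {ffun bool -> X} * K, injective p.1 /\ forall i, f (p.1 i) = p.2.
Proof.
move=> ltKX; have /injectivePn [x [y neq_xy eq_f]] : ~~ injectiveb f.
  by apply: contraL ltKX => /injectiveP /leq_card; rewrite -leqNgt.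
exists ([ffun i : bool => if i then x else y], f x); split=> /=.
  by move=> [] []; rewrite !ffunE // => eq_xy; rewrite eq_xy eqxx in neq_xy.
by case; rewrite ffunE.
Qed.

(** Pigeonhole three times: the pair chosen in C for (a, b), with its color, serves as the color of
    b; the resulting pair in B and its color serve as the color of a. These pairs-with-color number
    |C|^2 |K| and |B|^2 |C|^2 |K|, hence the hypotheses. *)
Lemma monochromatic_box (A B C K : finType) (f : A -> B -> C -> K) :
    (#|K| < #|C|)%N -> (#|C| ^ 2 * #|K| < #|B|)%N ->
    (#|B| ^ 2 * (#|C| ^ 2 * #|K|) < #|A|)%N ->
  exists (a : bool -> A) (b : bool -> B) (c : bool -> C) (k : K),
    [/\ injective a, injective b, injective c &
        forall i j l, f (a i) (b j) (c l) = k].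
Proof.
move=> ltKC ltKB ltKA.
have [p pP] := fin_all_exists (fun ab : A * B =>
  monochromatic_pair (f ab.1 ab.2) ltKC).
have ltB : (#|{: {ffun bool -> C} * K}| < #|B|)%N.
  by rewrite card_prod card_ffun card_bool.
have [q qP] := fin_all_exists (fun a =>
  monochromatic_pair (fun b => p (a, b)) ltB).
have ltA : (#|{: {ffun bool -> B} * ({ffun bool -> C} * K)}| < #|A|)%N.
  by rewrite !card_prod !card_ffun card_bool.
have [[a [b [c k]]] /= [inj_a aP]] := monochromatic_pair q ltA.
have bP i j : p (a i, b j) = (c, k) by have [_] := qP (a i); rewrite aP.
exists a, b, c, k; split=> //.
- by have [] := qP (a true); rewrite aP.
- by have [] := pP (a true, b true); rewrite bP.
- by move=> i j l; have [_] := pP (a i, b j); rewrite bP.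
Qed.

(** * Executions and covering maps *)

Section Execution.
Variables (N : nat) (A : algorithm N).

Definition message (V : finType) (G : sgraph V) (id : V -> 'I_N) s u v : bool :=
  send A (id u) (nbr_ids G id u) (received A G id s u) (id v).

Lemma received_isolated (V : finType) (G : sgraph V) (id : V -> 'I_N) t v :
  nbrs G v = set0 -> received A G id t v = nseq t [ffun=> None].
Proof.
move=> v0; elim: t => // t IHt.
rewrite -[in RHS]addn1 nseqD cats1 /= IHt; congr rcons; apply/ffunP => i.
by rewrite !ffunE; case: pickP => //= u; rewrite v0 inE.
Qed.

Section Covering.
Variables (V W : finType) (G : sgraph V) (H : sgraph W).
(** Nodes of one fiber of [rho] have different IDs, so no single labeling of H fits them all; [jd v]
    need only agree with [id] on v and its neighbors. *)
Variables (id : V -> 'I_N) (rho : V -> W) (jd : V -> W -> 'I_N).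
Hypothesis rhoG : forall v u, G v u -> H (rho v) (rho u).
Hypothesis rhoH : forall v w, H (rho v) w -> exists2 u, G v u & rho u = w.
Hypothesis jd_inj : forall v, injective (jd v).
Hypothesis jd_self : forall v, jd v (rho v) = id v.
Hypothesis jd_nbr : forall v u, G v u -> jd v (rho u) = id u.

Lemma covering_nbr_ids v : nbr_ids H (jd v) (rho v) = nbr_ids G id v.
Proof.
apply/setP => i; apply/imsetP/imsetP => [[w]|[u]]; rewrite inE => adjv ->.
  by have [u Gvu <-] := rhoH adjv; exists u; rewrite ?inE // jd_nbr.
by exists (rho u); rewrite ?inE ?rhoG // jd_nbr.
Qed.

(* If the executions of H under all the labelings [jd v] have the same        *)
(* transcript, then no node of the cover G can tell which graph it is in.     *)
Lemma covering_received T :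
    (forall v v' s w w', (s < T)%N ->
      message H (jd v) s w w' = message H (jd v') s w w') ->
  forall t v, (t <= T)%N -> received A H (jd v) t (rho v) = received A G id t v.
Proof.
move=> eq_msg; elim=> //= t IHt v lt_tT; rewrite IHt 1?ltnW //; congr rcons.
apply/ffunP => i; rewrite !ffunE.
case: (pickP [pred u in nbrs G v | id u == i]) => [u|noG] /=; last first.
  case: pickP => //= w /andP[]; rewrite inE => Hvw /eqP jdw.
  have [u Gvu rho_u] := rhoH Hvw.
  by have := noG u; rewrite /= inE Gvu -(jd_nbr Gvu) rho_u jdw eqxx.
rewrite inE => /andP[Gvu /eqP idu].
case: pickP => [w|/(_ (rho u))] /=; rewrite inE; last first.
  by rewrite rhoG //= jd_nbr // idu eqxx.
move=> /andP[_ /eqP jdw].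
have -> : w = rho u by apply: (@jd_inj v); rewrite jdw jd_nbr.
(* Passing from [jd v] to [jd u] makes the sender's surroundings match those of u in G, so the
   induction hypothesis applies at u. *)
have /= := eq_msg v u t (rho u) (rho v) lt_tT.
rewrite /message => ->; congr Some.
by rewrite covering_nbr_ids IHt 1?ltnW // jd_self jd_nbr // adj_sym.
Qed.

End Covering.
End Execution.

(** * The three graphs on six nodes *)

Definition edgeless_rel : rel 'I_6 := fun _ _ => false.
(** Nodes 3, 4, 5 are isolated and pad the triangle to six nodes. *)
Definition triangle_rel : rel 'I_6 :=
  fun i j => [&& i < 3, j < 3 & i != j :> nat].
(* By the Chinese remainder theorem this is the relation i = j +- 1 mod 6. *)
Definition hexagon_rel : rel 'I_6 :=
  fun i j => (odd i != odd j) && (i %% 3 != j %% 3).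

Lemma edgeless_sym : symmetric edgeless_rel. Proof. by []. Qed.
Lemma edgeless_irr : irreflexive edgeless_rel. Proof. by []. Qed.
Lemma triangle_sym : symmetric triangle_rel.
Proof. by move=> i j; rewrite /triangle_rel andbCA eq_sym. Qed.
Lemma triangle_irr : irreflexive triangle_rel.
Proof. by move=> i; rewrite /triangle_rel eqxx !andbF. Qed.
Lemma hexagon_sym : symmetric hexagon_rel.
Proof. by move=> i j; rewrite /hexagon_rel eq_sym [_ %% 3 == _]eq_sym. Qed.
Lemma hexagon_irr : irreflexive hexagon_rel.
Proof. by move=> i; rewrite /hexagon_rel eqxx. Qed.

Definition edgeless := SGraph edgeless_sym edgeless_irr.
Definition triangle := SGraph triangle_sym triangle_irr.
Definition hexagon := SGraph hexagon_sym hexagon_irr.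

Ltac case_I6 v := case: v => [[|[|[|[|[|[|v]]]]]] ?] //.

Lemma max_degree_le (G : sgraph 'I_6) d :
  (forall v, \sum_(u < 6) G v u <= d) -> max_degree G <= d.
Proof.
move=> leGd; apply/bigmax_leqP => v _; apply: leq_trans (leGd v).
by rewrite -sum1_card big_mkcond leq_sum // => u _; rewrite inE; case: (G v u).
Qed.

Lemma max_degree_edgeless : max_degree edgeless <= 2.
Proof. by apply: max_degree_le => v; rewrite big1. Qed.
Lemma max_degree_triangle : max_degree triangle <= 2.
Proof.
by apply: max_degree_le => v; rewrite !big_ord_recl big_ord0; case_I6 v.
Qed.
Lemma max_degree_hexagon : max_degree hexagon <= 2.
Proof.
by apply: max_degree_le => v; rewrite !big_ord_recl big_ord0; case_I6 v.
Qed.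

Lemma edgeless_no_triangle : ~ has_triangle edgeless.
Proof. by case=> u [v [w []]]. Qed.

Lemma triangle_has_triangle : has_triangle triangle.
Proof.
by exists (inord 0), (inord 1), (inord 2); split; rewrite /= /triangle_rel !inordK.
Qed.

Lemma hexagon_no_triangle : ~ has_triangle hexagon.
Proof.
case=> u [v [w [/andP[uv _] /andP[vw _] /andP[wu _]]]].
(* Parity is a proper 2-coloring of the hexagon. *)
by case: (odd u) (odd v) (odd w) uv vw wu => [] [] [].
Qed.

Definition mod3 (i : 'I_6) : 'I_6 := inord (i %% 3).

Lemma mod3E i : mod3 i = i %% 3 :> nat.
Proof. by rewrite inordK // (leq_trans (ltn_pmod _ _)). Qed.

Lemma mod3_hexagon u v : hexagon u v -> triangle (mod3 u) (mod3 v).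
Proof. by case/andP=> _; rewrite /= /triangle_rel !mod3E !ltn_pmod. Qed.

Lemma mod3_triangle v w :
  triangle (mod3 v) w -> exists2 u, hexagon v u & mod3 u = w.
Proof.
rewrite /= /triangle_rel mod3E => /and3P[_ w3 neq].
(* Of the two lifts w and w + 3, take the one whose parity differs from that of v. *)
exists (inord (if odd v == odd w then w + 3 else w)).
  rewrite /= /hexagon_rel inordK; last by case: ifP; lia.
  case: ifP => [/eqP ->|->]; rewrite ?modnDr ?(modn_small w3) ?neq ?oddD //.
  by case: (odd w).
apply: val_inj; rewrite /= mod3E inordK; last by case: ifP; lia.
by case: ifP; rewrite ?modnDr modn_small.
Qed.

(** * The bound on the namespace *)

Section Transcript.
Variables (N : nat) (A : algorithm N).
Hypothesis solvesA :
  solves_triangle_detection A (fun G : sgraph 'I_6 => max_degree G <= 2).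

(** Recording all 36 ordered pairs per round, adjacent or not, gives 36T + 6 bits. *)
Definition transcript (id : 'I_6 -> 'I_N) :
    {ffun 'I_(rounds A) * 'I_6 * 'I_6 -> bool} * {ffun 'I_6 -> bool} :=
  ([ffun p : 'I_(rounds A) * 'I_6 * 'I_6 => message A triangle id p.1.1 p.1.2 p.2],
   [ffun v => node_output A triangle id v]).

(** An isolated node cannot tell this graph from the edgeless one, where NO is forced; so a YES
    comes from the triangle itself. *)
Lemma isolated_output (id : 'I_6 -> 'I_N) (v : 'I_6) :
  injective id -> 3 <= v -> node_output A triangle id v = false.
Proof.
move=> inj_id v3.
have tri0 : nbrs triangle v = set0.
  by apply/setP => u; rewrite !inE /= /triangle_rel ltnNge v3.
have edge0 : nbrs edgeless v = set0 by apply/setP => u; rewrite !inE.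
have [/(_ edgeless_no_triangle v) <- _] :=
  solvesA max_degree_edgeless inj_id.
by rewrite /node_output !received_isolated // /nbr_ids tri0 edge0.
Qed.

(** Some v < 3 says YES under one [jd], hence under [jd v]. As [mod3] fixes v, node v of the hexagon
    says YES too. *)
Lemma hexagon_distinguished (id : 'I_6 -> 'I_N) (jd : 'I_6 -> 'I_6 -> 'I_N) :
    injective id -> (forall v, injective (jd v)) ->
    (forall v, jd v (mod3 v) = id v) ->
    (forall v u, hexagon v u -> jd v (mod3 u) = id u) ->
  ~ (forall v v', transcript (jd v) = transcript (jd v')).
Proof.
move=> inj_id inj_jd jd_self jd_nbr eq_tr.
have [_ /(_ triangle_has_triangle) [v out_v]] :=
  solvesA max_degree_triangle (inj_jd ord0).
have v3 : v < 3 by rewrite ltnNge; apply: contraPN out_v => /isolated_output ->.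
have mod3v : mod3 v = v by apply: val_inj; rewrite /= mod3E modn_small.
have eq_msg u u' s w w' : s < rounds A ->
    message A triangle (jd u) s w w' = message A triangle (jd u') s w w'.
  move=> ltsT; have [/ffunP/(_ (Ordinal ltsT, w, w')) + _] := eq_tr u u'.
  by rewrite !ffunE.
have [_ /ffunP/(_ v)] := eq_tr ord0 v; rewrite !ffunE out_v.
have [/(_ hexagon_no_triangle v) + _] := solvesA max_degree_hexagon inj_id.
rewrite /node_output -(covering_nbr_ids mod3_hexagon mod3_triangle jd_nbr).
rewrite -(covering_received mod3_hexagon mod3_triangle inj_jd jd_self jd_nbr
  (T := rounds A)) //.
by rewrite -jd_self mod3v => ->.
Qed.

Lemma namespace_bound : N < 2 ^ (324 * rounds A + 65).
Proof.
set T := rounds A; pose m := 36 * T + 6.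
rewrite ltnNge; apply/negP => leN.
(* Disjoint ID pools for the three roles and the isolated nodes keep every labeling injective. The
   exponents exceed m, 2(m+1) + m and 2(3m+3) + (3m+2) by one, as the pigeonhole requires; the four
   pools total at most 4 * 2^(9m+9) IDs. *)
pose Z := 'I_(2 ^ m.+1); pose Y := 'I_(2 ^ (3 * m + 3)).
pose X := 'I_(2 ^ (9 * m + 9)); pose S := (X + Y + Z + 'I_3)%type.
have leSN : #|{: S}| <= N.
  apply: leq_trans leN; rewrite !card_sum !card_ord.
  have -> : 324 * T + 65 = (9 * m + 9) + 2 by rewrite /m; lia.
  have leM e : e <= 9 * m + 9 -> 2 ^ e <= 2 ^ (9 * m + 9) by rewrite leq_exp2l.
  have [] : [/\ 2 ^ (3 * m + 3) <= 2 ^ (9 * m + 9), 2 ^ m.+1 <= 2 ^ (9 * m + 9)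
    & 2 ^ 2 <= 2 ^ (9 * m + 9)] by split; apply: leM; lia.
  rewrite [in X in _ -> _ -> _ -> X](expnD _ _ 2).
  by move: (2 ^ (9 * m + 9)) => M; lia.
pose g (s : S) : 'I_N := widen_ord leSN (enum_rank s).
have inj_g : injective g by move=> s t /(congr1 val) /= /val_inj /enum_rank_inj.
pose lab x y z : 6.-tuple S := [tuple inl (inl (inl x)); inl (inl (inr y));
  inl (inr z); inr (inord 0); inr (inord 1); inr (inord 2)].
have uniq_lab x y z : uniq (lab x y z).
  by rewrite /= !inE /= !(inj_eq inr_inj) -!val_eqE /= !inordK.
pose f x y z := transcript (g \o tnth (lab x y z)).
have cardK :
    #|{: {ffun 'I_T * 'I_6 * 'I_6 -> bool} * {ffun 'I_6 -> bool}}| = 2 ^ m.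
  rewrite card_prod !card_ffun !card_prod !card_ord card_bool -expnD.
  by congr (2 ^ _); rewrite /m; lia.
have [||| a [b [c [k [inj_a inj_b inj_c fk]]]]] := @monochromatic_box X Y Z _ f.
- by rewrite cardK card_ord ltn_exp2l.
- by rewrite cardK !card_ord -expnM -expnD ltn_exp2l //; lia.
- by rewrite cardK !card_ord -!expnM -!expnD ltn_exp2l //; lia.
(* Node r + 3 e of the hexagon is copy e of role r; the triangle [jd v] uses, *)
(* in each role, the copy that is v or a neighbor of v.                       *)
pose jd (v : 'I_6) := g \o tnth
  (lab (a (2 <= v <= 4)) (b (3 <= v)) (c (~~ (1 <= v <= 3)))).
pose hex : 6.-tuple S :=
  [tuple inl (inl (inl (a false))); inl (inl (inr (b false))); inl (inr (c false));
    inl (inl (inl (a true))); inl (inl (inr (b true))); inl (inr (c true))].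
have uniq_hex : uniq hex.
  by rewrite /= !inE /= ?(inj_eq inl_inj, inj_eq inr_inj, inj_eq inj_a,
                          inj_eq inj_b, inj_eq inj_c).
apply: (@hexagon_distinguished (g \o tnth hex) jd).
- by apply: inj_comp inj_g _; apply/tuple_uniqP.
- by move=> v; apply: inj_comp inj_g _; apply/tuple_uniqP.
- move=> v; congr g; rewrite !(tnth_nth (inr ord0)) mod3E.
  by case_I6 v.
- move=> v u vu; congr g; rewrite !(tnth_nth (inr ord0)) mod3E.
  by move: vu; case_I6 v; case_I6 u.
by move=> v v'; rewrite /jd -!/(f _ _ _) !fk.
Qed.

End Transcript.

(** * From log to log* *)

(** One logarithm brings n to at most m + 1; by [log2_le_nat] each further one lowers the integer
    bound by one. *)
Lemma log_star_le (R : realType) n m : n <= 2 ^ m -> log_star R n <= m.+1.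
Proof.
move=> le_n2m; rewrite /log_star; case: ex_minnP => j _ minj.
have H p (x : R) : (x <= p.+1%:R)%R -> exists2 k, k <= p & (iter k (@log2 R) x <= 1)%R.
  elim: p x => [|p IHp] x lexp; first by exists 0.
  have [k lekp itk] := IHp _ (log2_le_nat lexp).
  by exists k.+1; rewrite ?iterSr.
have ln2_gt0 : (0 < ln (2 : R))%R by rewrite ln_gt0 // ltr1n.
have /H [k lekm itk] : (log2 (n%:R : R) <= m.+1%:R)%R.
  rewrite /log2 ler_pdivrMr //; case: n le_n2m {minj} => [|n] le_n2m.
    by rewrite ln0 // mulr_ge0 // ltW.
  apply: (@le_trans _ _ (m%:R * ln 2)%R).
    rewrite mulr_natl -lnXn // ler_ln ?posrE ?exprn_gt0 //.
    by rewrite -natrX ler_nat.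
  by rewrite ler_pM2r // ler_nat.
apply: leq_trans (minj k.+1 _) _ => //.
by rewrite iterSr.
Qed.

Local Open Scope ring_scope.

Theorem theorem4 (R : realType) :
  exists (c : R) (N0 : nat), 0 < c /\
    forall N : nat, (N0 <= N)%N ->
    forall A : algorithm N,
      solves_triangle_detection A
        (fun G : sgraph 'I_6 => (max_degree G <= 2)%N) ->
      c * (log_star R N)%:R <= (rounds A)%:R.
Proof.
(* N at least 2^65 forces T > 0, so 324T + 65 <= 389T and log* N <= 389T + 1 <= 390T. *)
exists (390%:R^-1), (2 ^ 65)%N; split; first by rewrite invr_gt0 ltr0n.
move=> N leN A /namespace_bound ltN.
have T_gt0 : (0 < rounds A)%N.
  have := leq_ltn_trans leN ltN; rewrite ltn_exp2l //; lia.
rewrite mulrC ler_pdivrMr ?ltr0n // -natrM ler_nat.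
apply: leq_trans (log_star_le R (m := 389 * rounds A) _) _; last by lia.
by apply: leq_trans (ltnW ltN) _; rewrite leq_exp2l //; lia.
Qed.
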